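(* Let $\Gamma$ be a finite simplicial graph and let $\Gamma^{\mathrm{e}}$ be its extension graph. Then there exists an infinite sequence $\{\Gamma_i\}_{i\ge 0}$ of finite induced subgraphs of $\Gamma^{\mathrm{e}}$ such that for each $i\ge 0$ the graph $\Gamma_{i+1}$ is (isomorphic to) the double of $\Gamma_i$ along the star of some vertex of $\Gamma_i$, and such that every finite induced subgraph of $\Gamma^{\mathrm{e}}$ is isomorphic to an induced subgraph of some $\Gamma_i$.
   Context: For a finite simplicial graph $\Gamma$ with vertex set $V$, the right-angled Artin group is $A(\Gamma)=\langle V \mid [a,b]=1 \text{ for } \{a,b\}\in E(\Gamma)\rangle$. For $u,w\in A(\Gamma)$ write $u^w=w^{-1}uw$, and for subsets $U,W\subseteq A(\Gamma)$ write $U^W=\{u^w: u\in U, w\in W\}$. Put $V^{\mathrm{e}}=V^{A(\Gamma)}$. The extension graph $\Gamma^{\mathrm{e}}$ is the simplicial graph with vertex set $V^{\mathrm{e}}$ in which two distinct vertices $x,y$ are adjacent iff $[x,y]=1$ in $A(\Gamma)$. For a graph $X$ and a vertex $v$, the star $\mathrm{st}_X(v)$ is the set of vertices equal or adjacent to $v$. The double of $X$ along the star of $v$ is the graph $Y$ defined as follows: take sets $S_0,S_1$ with bijections $\rho_i: S_i\to V(X)\setminus \mathrm{st}(v)$; set $V(Y)=S_0\sqcup S_1\sqcup \mathrm{st}(v)$, and $\{a,b\}\in E(Y)$ iff one of: (i) $a,b\in S_i$ and $\{\rho_i(a),\rho_i(b)\}\in E(X)$ for some $i\in\{0,1\}$;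 (ii) $a\in S_i$, $b\in \mathrm{st}(v)$ and $\{\rho_i(a),b\}\in E(X)$ for some $i\in\{0,1\}$; (iii) $a,b\in\mathrm{st}(v)$ and $\{a,b\}\in E(X)$. *)

(* Defs.v *)
From HB Require Import structures.
From mathcomp Require Import all_boot.
From mathcomp Require Import boolp.
From Stdlib Require Import Relations.

Set Implicit Arguments.
Unset Strict Implicit.
Unset Printing Implicit Defensive.

Record fgraph := FGraph { fvert : finType ; fadj : rel fvert }.
Arguments fadj : clear implicits.

Definition graph_iso (G H : fgraph) : Prop :=
  exists f : fvert G -> fvert H,
    bijective f /\ forall x y, fadj G x y = fadj H (f x) (f y).

Definition induced_emb (G H : fgraph) : Prop :=
  exists f : fvert G -> fvert H,
    injective f /\ forall x y, fadj G x y = fadj H (f x) (f y).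

Section Double.
Variables (X : fgraph) (v : fvert X).

Definition star (x : fvert X) : bool := (x == v) || fadj X v x.

Definition dbl_out := {x : fvert X | ~~ star x}.
Definition dbl_in := {x : fvert X | star x}.

(* S_0 and S_1 are the two copies (false, _) and (true, _) of V(X) \ st(v) *)
Definition dbl_vert : finType := ((bool * dbl_out) + dbl_in)%type.

Definition dbl_adj (a b : dbl_vert) : bool :=
  match a, b with
  | inl (i, x), inl (j, y) => (i == j) && fadj X (val x) (val y)
  | inl (_, x), inr y => fadj X (val x) (val y)
  | inr y, inl (_, x) => fadj X (val y) (val x)
  | inr x, inr y => fadj X (val x) (val y)
  end.

Definition star_double : fgraph := FGraph dbl_adj.
End Double.

(* Gamma: vertex finType T with edge relation E.  Elements of A(Gamma) are
   represented by words in the letters (a, false) = a and (a, true) = a^-1;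
   equality in A(Gamma) is the congruence [raag_eq] generated by free
   cancellation and commutation of adjacent generators. *)
Section RAAG.
Variables (T : finType) (E : rel T).

Definition word := seq (T * bool).

Definition winv (w : word) : word := rev (map (fun p => (p.1, ~~ p.2)) w).

Inductive raag_step : word -> word -> Prop :=
| rs_cancel (w1 w2 : word) (a : T) (b : bool) :
    raag_step (w1 ++ [:: (a, b); (a, ~~ b)] ++ w2) (w1 ++ w2)
| rs_comm (w1 w2 : word) (a c : T) (b d : bool) : E a c ->
    raag_step (w1 ++ [:: (a, b); (c, d)] ++ w2) (w1 ++ [:: (c, d); (a, b)] ++ w2).

Definition raag_eq : word -> word -> Prop := clos_refl_sym_trans word raag_step.

Definition wconj (u w : word) : word := winv w ++ u ++ w.

Definition is_ext_vertex (u : word) : Prop :=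
  exists (a : T) (w : word), raag_eq u (wconj [:: (a, false)] w).

Definition wcommute (x y : word) : Prop := raag_eq (x ++ y) (y ++ x).

(* A finite set of vertices of Gamma^e, given as a list S of representatives
   of pairwise distinct elements of V^e. *)
Definition ext_vset (S : seq word) : Prop :=
  (forall u, u \in S -> is_ext_vertex u) /\
  (forall i j : 'I_(size S), raag_eq (nth [::] S i) (nth [::] S j) -> i = j).

Definition ext_subgraph (S : seq word) : fgraph :=
  @FGraph 'I_(size S) (fun i j =>
    `[< ~ raag_eq (nth [::] S i) (nth [::] S j) /\
        wcommute (nth [::] S i) (nth [::] S j) >]).
End RAAG.

(* Main.v *)
From Stdlib Require Import Relations.
Require Import Defs.
From mathcomp Require Import all_boot.
From HB Require Import structures.
From mathcomp Require Import all_fingroup generic_quotient zmodp cyclic boolp.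

(* For a vertex v of a graph X, the kernel of the map A(X) -> Z/2 sending v to 1
   and all other vertices to 0 is generated by v^2, the other vertices x, and
   their conjugates x^v; it is the right-angled Artin group of the double of X
   along st(v).  Iterating from Gamma gives doubles whose vertices lie in
   Gamma^e and have powers generating a right-angled Artin subgroup H of
   A(Gamma), so that adjacency in the double is commutation in A(Gamma).
   Each vertex of Gamma^e has the form x^h with x a vertex of the current
   double and h in H.  Rewriting h in the generators of the next subgroup never
   lengthens it, and shortens it when one doubles at the last letter of h
   (conjugating by that letter, with its sign).  Hence a sequence of doublings
   that serves every element of Gamma^e infinitely often exhausts Gamma^e. *)

Set Implicit Arguments.
Unset Strict Implicit.
Unset Printing Implicit Defensive.

(** * The group A(Gamma) as a quotient of words *)

Section WordCongruence.
Local Open Scope quotient_scope.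
Variables (T : finType) (E : rel T).
Implicit Types u v w : word T.

Lemma raag_refl w : raag_eq E w w. Proof. exact: rst_refl. Qed.

Lemma raag_sym u v : raag_eq E u v -> raag_eq E v u.
Proof. exact: rst_sym. Qed.

Lemma raag_trans v u w : raag_eq E u v -> raag_eq E v w -> raag_eq E u w.
Proof. exact: rst_trans. Qed.

Lemma raag_ctx p q u v : raag_eq E u v -> raag_eq E (p ++ u ++ q) (p ++ v ++ q).
Proof.
elim=> [{}u {}v st|w|{}u {}v _ IH|{}u w {}v _ IH1 _ IH2].
- apply: rst_step; case: st => [w1 w2 a b|w1 w2 a c b d Eac].
    by have := rs_cancel E (p ++ w1) (w2 ++ q) a b; rewrite -!catA.
  by have := rs_comm (p ++ w1) (w2 ++ q) b d Eac; rewrite -!catA.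
- exact: raag_refl.
- exact: raag_sym.
- exact: raag_trans IH2.
Qed.

Lemma raag_cat u u' v v' :
  raag_eq E u u' -> raag_eq E v v' -> raag_eq E (u ++ v) (u' ++ v').
Proof.
move=> eu ev; apply: (@raag_trans (u' ++ v)); first exact: (raag_ctx [::] v).
by have := raag_ctx u' [::] ev; rewrite !cats0.
Qed.

Lemma raag_cancel w a b : raag_eq E ((a, b) :: (a, ~~ b) :: w) w.
Proof. exact/rst_step/(rs_cancel E [::] w). Qed.

Lemma raag_swap w a c b d :
  E a c -> raag_eq E ((a, b) :: (c, d) :: w) ((c, d) :: (a, b) :: w).
Proof. by move=> Eac; apply/rst_step/(rs_comm [::] w). Qed.

Lemma raag_cons l u v : raag_eq E u v -> raag_eq E (l :: u) (l :: v).
Proof. by move=> uv; apply: (@raag_cat [:: l] [:: l]) uv; apply: raag_refl. Qed.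

Lemma winv_cat u v : winv (u ++ v) = winv v ++ winv u.
Proof. by rewrite /winv map_cat rev_cat. Qed.

Lemma winvK u : winv (winv u) = u.
Proof.
rewrite /winv map_rev revK -map_comp map_id_in // => -[a b] _ /=.
by rewrite negbK.
Qed.

Lemma raag_winvr u : raag_eq E (u ++ winv u) [::].
Proof.
elim: u => [|[a b] u IH]; first exact: raag_refl.
rewrite -[_ :: u]/([:: (a, b)] ++ u) winv_cat.
have := raag_ctx [:: (a, b)] (winv [:: (a, b)]) IH; rewrite -!catA.
by move=> /raag_trans; apply; apply: raag_cancel.
Qed.

(** Uniqueness of inverses: [winv v ++ v ++ winv u] reduces to either side, so no induction on the
    derivation is made. *)
Lemma raag_winv u v : raag_eq E u v -> raag_eq E (winv u) (winv v).
Proof.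
move=> uv; have h := raag_winvr (winv v); rewrite winvK in h.
have := raag_cat h (raag_refl (winv u)); rewrite /= => /raag_sym/raag_trans.
apply; rewrite -catA; have := raag_cat (raag_sym uv) (raag_refl (winv u)).
move/raag_trans/(_ (raag_winvr u)) => /(raag_cat (raag_refl (winv v))).
by rewrite cats0.
Qed.

(** A classical truth value, so that the quotient can be formed without solving the word problem. *)
Definition raag_rel u v := `[< raag_eq E u v >].

Lemma raag_rel_equiv : equiv_class_of raag_rel.
Proof.
split=> [u|u v|v u w]; first exact/asboolP/raag_refl.
  by apply/asboolP/asboolP; apply: raag_sym.
by move=> /asboolP uv /asboolP vw; apply/asboolP/(raag_trans uv).
Qed.

Canonical raag_equiv := EquivRelPack raag_rel_equiv.

Definition raag := {eq_quot raag_equiv}.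
HB.instance Definition _ := Choice.on raag.
HB.instance Definition _ := EqQuotient.on raag.

Definition raag_class (w : word T) : raag := \pi_raag%qT w.

Lemma raag_classP u v : raag_class u = raag_class v <-> raag_eq E u v.
Proof.
split=> [/eqP|uv]; last by apply/eqP; rewrite eqmodE; apply/asboolP.
by rewrite eqmodE => /asboolP.
Qed.

Lemma repr_raag (g : raag) : raag_class (repr g) = g.
Proof. exact: reprK. Qed.

Definition raag_mul (g h : raag) := raag_class (repr g ++ repr h).
Definition raag_inv (g : raag) := raag_class (winv (repr g)).

Lemma raag_mulE u v : raag_mul (raag_class u) (raag_class v) = raag_class (u ++ v).
Proof. by apply/raag_classP/raag_cat; apply/raag_classP/repr_raag. Qed.

Lemma raag_invE u : raag_inv (raag_class u) = raag_class (winv u).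
Proof. by apply/raag_classP/raag_winv; apply/raag_classP/repr_raag. Qed.

Lemma raag_mulA : associative raag_mul.
Proof.
move=> f g h; rewrite -(repr_raag f) -(repr_raag g) -(repr_raag h).
by rewrite !raag_mulE catA.
Qed.

Lemma raag_mul1 : left_id (raag_class [::]) raag_mul.
Proof. by move=> f; rewrite -(repr_raag f) raag_mulE. Qed.

Lemma raag_mulr1 : right_id (raag_class [::]) raag_mul.
Proof. by move=> f; rewrite -(repr_raag f) raag_mulE cats0. Qed.

Lemma raag_mulV : left_inverse (raag_class [::]) raag_inv raag_mul.
Proof.
move=> f; rewrite -(repr_raag f) raag_invE raag_mulE; apply/raag_classP.
by have := raag_winvr (winv (repr f)); rewrite winvK.
Qed.

Lemma raag_mulrV : right_inverse (raag_class [::]) raag_inv raag_mul.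
Proof.
move=> f; rewrite -(repr_raag f) raag_invE raag_mulE; apply/raag_classP.
exact: raag_winvr.
Qed.

HB.instance Definition _ :=
  isGroup.Build raag raag_mulA raag_mul1 raag_mulr1 raag_mulV raag_mulrV.

End WordCongruence.

(** * Evaluation of words in an arbitrary group *)

Section Evaluation.
Local Open Scope group_scope.
Variables (T : finType) (G : groupType) (f : T -> G).
Implicit Types (u w : word T) (l : T * bool).

Definition eval_letter l : G := if l.2 then (f l.1)^-1 else f l.1.
Definition eval w : G := \prod_(l <- w) eval_letter l.

Lemma eval_nil : eval [::] = 1. Proof. exact: big_nil. Qed.

Lemma eval_cons l w : eval (l :: w) = eval_letter l * eval w.
Proof. exact: big_cons. Qed.

Lemma eval_cat u w : eval (u ++ w) = eval u * eval w.
Proof. exact: big_cat. Qed.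

Lemma eval_nseq n l : eval (nseq n l) = eval_letter l ^+ n.
Proof. by elim: n => [|n IH]; rewrite ?eval_nil //= eval_cons IH expgS. Qed.

Lemma eval_letterN a b : eval_letter (a, ~~ b) = (eval_letter (a, b))^-1.
Proof. by case: b; rewrite /eval_letter /= ?invgK. Qed.

Lemma commute_eval_letter x l : commute x (f l.1) -> commute x (eval_letter l).
Proof. by rewrite /eval_letter; case: l.2 => // /commuteV. Qed.

(** Universal property of A(Gamma): it suffices to check the defining relations in the target
    group. *)
Lemma eval_raag (E : rel T) u w :
  (forall x y, E x y -> commute (f x) (f y)) ->
  raag_eq E u w -> eval u = eval w.
Proof.
move=> fE; elim=> [{}u {}w st|{}u|{}u {}w _ <-|{}u v {}w _ -> _ ->] //.
case: st => [w1 w2 a b|w1 w2 a c b d Eac].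
  by rewrite !eval_cat !eval_cons eval_nil eval_letterN mulg1 mulgV mul1g.
rewrite !eval_cat; congr (_ * (_ * _)); rewrite !eval_cons eval_nil !mulg1.
apply: commute_eval_letter => /=; apply/commute_sym/commute_eval_letter.
exact/commute_sym/fE.
Qed.

End Evaluation.

(** * Generators of A(Gamma): commutation and powers *)

Section RaagGenerators.
Local Open Scope group_scope.
Variables (T : finType) (E : rel T).

Definition gen (a : T) : raag E := raag_class E [:: (a, false)].

Lemma raag_classM u v : raag_class E (u ++ v) = raag_class E u * raag_class E v.
Proof. by rewrite -raag_mulE. Qed.

Lemma raag_classV u : raag_class E (winv u) = (raag_class E u)^-1.
Proof. by rewrite -raag_invE. Qed.

Lemma eval_gen w : eval gen w = raag_class E w.
Proof.
elim: w => [|[a b] w IH]; first by rewrite eval_nil.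
rewrite eval_cons IH -[_ :: w]/([:: (a, b)] ++ w) raag_classM; congr (_ * _).
by rewrite /eval_letter; case: b; rewrite // -raag_classV.
Qed.

Lemma wcommuteP u v :
  wcommute E u v <-> commute (raag_class E u) (raag_class E v).
Proof. by rewrite /wcommute -raag_classP !raag_classM. Qed.

Lemma is_ext_vertexP u :
  is_ext_vertex E u <-> exists a g, raag_class E u = gen a ^ g.
Proof.
split=> [[a [w /raag_classP ->]]|[a [g]]].
  by exists a, (raag_class E w); rewrite /wconj !raag_classM raag_classV.
rewrite -(repr_raag g) => e; exists a, (repr g); apply/raag_classP.
by rewrite e /wconj !raag_classM raag_classV.
Qed.

Hypotheses (Esym : symmetric E) (Eirr : irreflexive E).

(* Both lemmas test words against finite quotients of A(Gamma): the symmetric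
   group on three letters and cyclic groups. *)
Lemma commute_gen x y : x != y -> commute (gen x) (gen y) -> E x y.
Proof.
move=> xy; rewrite -wcommuteP => cxy; apply/negP => /negP nE.
(* The map to the symmetric group respects the relations because x and y are not adjacent; the
   products ab and ba send 0 to 2 and to 1. *)
pose a : 'S_3 := tperm (inord 0) (inord 1).
pose b : 'S_3 := tperm (inord 1) (inord 2).
pose f z : 'S_3 := if z == x then a else if z == y then b else 1.
have fE z t : E z t -> commute (f z) (f t).
  have yx : ~~ E y x by rewrite Esym.
  rewrite /f; case: (z =P x) => [->|_]; case: (t =P x) => [->|_];
    try case: (z =P y) => [->|_]; try case: (t =P y) => [->|_];
    rewrite ?Eirr ?(negPf nE) ?(negPf yx) //;
    by move=> _; rewrite /commute !(mulg1, mul1g).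
have := eval_raag fE cxy; rewrite !eval_cons !eval_nil /eval_letter /= !mulg1.
rewrite /f eqxx eq_sym (negPf xy) eqxx => /permP/(_ (inord 0)).
rewrite !permM /a /b tpermL tpermL.
have n01 : inord 0 != inord 1 :> 'I_3 by rewrite -val_eqE /= !inordK.
have n02 : inord 0 != inord 2 :> 'I_3 by rewrite -val_eqE /= !inordK.
have n12 : inord 1 != inord 2 :> 'I_3 by rewrite -val_eqE /= !inordK.
rewrite (@tpermD _ (inord 1) (inord 2) (inord 0)) 1?eq_sym // tpermL => e.
by rewrite e eqxx in n12.
Qed.

Lemma expg_gen_neq x y m n :
  x != y -> 0 < m -> gen x ^+ m <> gen y ^+ n.
Proof.
move=> xy m0; have e z k : gen z ^+ k = raag_class E (nseq k (z, false)).
  by rewrite -eval_gen eval_nseq.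
rewrite !e => /raag_classP xyE.
(* In the cyclic group of order m+1 the m-th power of a generator is nontrivial, as 0 < m < m+1,
   whereas y is killed. *)
pose f z : 'I_m.+1 := if z == x then Zp1 else 1.
have fE z t : E z t -> commute (f z) (f t).
  by move=> _; apply: Zp_mulgC.
have := eval_raag fE xyE; rewrite !eval_nseq /eval_letter /= /f eqxx.
rewrite eq_sym (negPf xy) expg1n => /eqP; rewrite -order_dvdn order_Zp1.
by move=> /dvdn_leq; rewrite m0 ltnn => /(_ isT).
Qed.

End RaagGenerators.

(** * Coordinates on the double: side and projection *)

Section DoubleVertices.
Variables (X : Defs.fgraph) (v : fvert X).

Definition dbl_proj (y : dbl_vert v) : fvert X :=
  match y with inl (_, x) => val x | inr x => val x end.

(** Star vertices get the dummy side [false], so that side and projection determine the vertex. *)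
Definition dbl_side (y : dbl_vert v) : bool :=
  if y is inl (i, _) then i else false.

Lemma star_self : star v v. Proof. by rewrite /star eqxx. Qed.

(* The last branch is never reached. *)
Definition dbl_lift (i : bool) (x : fvert X) : dbl_vert v :=
  if insub x is Some p then inr p
  else if insub x is Some q then inl (i, q)
  else inr (exist _ v star_self).

Lemma dbl_projK y : dbl_lift (dbl_side y) (dbl_proj y) = y.
Proof.
case: y => [[i q]|p] /=; rewrite /dbl_lift ?valK //.
by rewrite insubF ?valK //; apply/negbTE/(valP q).
Qed.

Lemma dbl_liftP i x :
  dbl_proj (dbl_lift i x) = x /\ dbl_side (dbl_lift i x) = i && ~~ star v x.
Proof.
rewrite /dbl_lift; have [sx|sx] := boolP (star v x).
  by rewrite insubT /= andbF.
by rewrite insubF ?(negPf sx) // insubT /= andbT.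
Qed.

Lemma dbl_liftK i x : dbl_proj (dbl_lift i x) = x.
Proof. by case: (dbl_liftP i x). Qed.

Lemma dbl_side_lift i x : dbl_side (dbl_lift i x) = i && ~~ star v x.
Proof. by case: (dbl_liftP i x). Qed.

Lemma star_dbl_side y : star v (dbl_proj y) -> dbl_side y = false.
Proof. by case: y => [[i [x p]]|[x p]] //= q; rewrite q in p. Qed.

Lemma dbl_lift_star i j x : star v x -> dbl_lift i x = dbl_lift j x.
Proof.
move=> sx; rewrite -[LHS]dbl_projK -[RHS]dbl_projK !dbl_liftK.
by rewrite !dbl_side_lift sx !andbF.
Qed.

(** Adjacency in coordinates, replacing the case analysis: the two copies meet only through the
    star. *)
Lemma dbl_adjE a b : dbl_adj a b =
  fadj X (dbl_proj a) (dbl_proj b) &&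
  [|| star v (dbl_proj a), star v (dbl_proj b) | dbl_side a == dbl_side b].
Proof.
case: a b => [[i [x p]]|[x p]] [[j [y q]]|[y q]] /=.
all: by rewrite ?p ?q ?(negPf p) ?(negPf q) ?orbT ?andbT //= andbC.
Qed.

Lemma dbl_adj_sym : symmetric (fadj X) -> symmetric (@dbl_adj X v).
Proof.
move=> symX a b; rewrite !dbl_adjE symX orbCA.
by rewrite [dbl_side a == _]eq_sym.
Qed.

Lemma dbl_adj_irr : irreflexive (fadj X) -> irreflexive (@dbl_adj X v).
Proof. by move=> irrX a; rewrite dbl_adjE irrX. Qed.

End DoubleVertices.

(* Let t = v or v^-1 according to s.  With H the kernel of A(X) -> Z/2 from the
   introduction, [schreier] writes u as t^e h with h in H (its second component
   being a word for h), and [unfold] is the inclusion of H.  The letter v of the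
   double stands for v^2, and the second copy of x for x^t. *)
Section Schreier.
Variables (X : Defs.fgraph) (v : fvert X) (s : bool).
Hypotheses (symX : symmetric (fadj X)) (irrX : irreflexive (fadj X)).
Local Notation Y := (dbl_vert v).
Local Notation eqX := (raag_eq (fadj X)).
Local Notation eqY := (raag_eq (@dbl_adj X v)).

(** Left multiplication of t^e h by a letter. A letter x other than v moves past t^e and becomes its
    conjugate by t^e. The letter t at e = 0 and t^-1 at e = 1 only flip e; in the other two cases a
    factor t^2 or t^-2 is also emitted, as a letter v of the double. *)
Definition schreier_step (l : fvert X * bool) (z : bool * word Y) : bool * word Y :=
  (z.1 (+) (l.1 == v),
   if (l.1 == v) && ((l.2 == s) != z.1) then z.2
   else (dbl_lift v z.1 l.1, l.2) :: z.2).

Definition schreier (u : word (fvert X)) : bool * word Y :=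
  foldr schreier_step (false, [::]) u.

Definition unfold_letter (l : Y * bool) : word (fvert X) :=
  let x := dbl_proj l.1 in
  if x == v then [:: (v, l.2); (v, l.2)]
  else if dbl_side l.1 then [:: (v, ~~ s); (x, l.2); (v, s)]
  else [:: (x, l.2)].

Definition unfold (h : word Y) : word (fvert X) := flatten (map unfold_letter h).

Lemma unfold_cons l h : unfold (l :: h) = unfold_letter l ++ unfold h.
Proof. by []. Qed.

Lemma schreier_unfold h : schreier (unfold h) = (false, h).
Proof.
elim: h => [//|[y b] h IH]; rewrite /schreier unfold_cons foldr_cat.
rewrite -/(schreier _) IH /unfold_letter /=; have := dbl_projK y.
case: (dbl_proj y =P v) => [yv|/eqP yv].
  rewrite yv (star_dbl_side (y := y)) ?yv ?star_self // => <-.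
  rewrite /= /schreier_step /= eqxx /= (dbl_lift_star true false (star_self v)).
  by case: b; case: (s).
case: (dbl_side y) => <- /=; rewrite /schreier_step /= dbl_liftK (negPf yv) //=.
by rewrite !eqxx /=; case: (s).
Qed.

Definition schreier_eq (z z' : bool * word Y) := z.1 = z'.1 /\ eqY z.2 z'.2.

Lemma schreier_step_eq l z z' :
  schreier_eq z z' -> schreier_eq (schreier_step l z) (schreier_step l z').
Proof.
case: z z' => [e h] [e' h'] [/= <- hh']; split=> //=.
by case: ifP => // _; apply: raag_cons.
Qed.

Lemma foldr_schreier_eq u z z' : schreier_eq z z' ->
  schreier_eq (foldr schreier_step z u) (foldr schreier_step z' u).
Proof. by move=> zz'; elim: u => //= l u; apply: schreier_step_eq. Qed.

Lemma schreier_step_cancel a b z :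
  schreier_eq (schreier_step (a, b) (schreier_step (a, ~~ b) z)) z.
Proof.
case: z => e h; split; rewrite /schreier_step /=; first by rewrite addbK.
case: (a =P v) => [->|_] /=; last by rewrite addbF; apply: raag_cancel.
(* The two letters are both absorbed or both emitted; emitted ones cancel, since v has a single copy
   in the double. *)
have vv h' : eqY ((dbl_lift v (~~ e) v, b) :: (dbl_lift v e v, ~~ b) :: h') h'.
  by rewrite (dbl_lift_star (~~ e) e (star_self v)); apply: raag_cancel.
have vv0 := vv h; have hh := raag_refl (@dbl_adj X v) h.
by rewrite addbT; case: e {vv} vv0; case: b; case: (s).
Qed.

(** If one letter is v, the other lies in the star, so its lift does not depend on e; otherwise both
    are lifted to the same side, where adjacency persists. *)
Lemma schreier_step_comm a b c d z : fadj X a c ->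
  schreier_eq (schreier_step (a, b) (schreier_step (c, d) z))
              (schreier_step (c, d) (schreier_step (a, b) z)).
Proof.
case: z => e h ac; split; rewrite /schreier_step /=; first by rewrite addbAC.
have sv x i j : fadj X v x -> dbl_lift v i x = dbl_lift v j x.
  by move=> vx; apply: dbl_lift_star; rewrite /star vx orbT.
have adjYl i x y : fadj X x y -> dbl_adj (dbl_lift v i x) (dbl_lift v i y).
  move=> xy; rewrite dbl_adjE !dbl_liftK xy !dbl_side_lift.
  by case: (star v x); case: (star v y); rewrite ?orbT //= eqxx.
case: (a =P v) ac => [->|_] ac; case: (c =P v) ac => [->|_] ac /=.
- by rewrite irrX in ac.
- rewrite addbT addbF (sv c (~~ e) e) //; case: ifP => _; first exact: raag_refl.
  exact/raag_swap/adjYl.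
- rewrite addbT addbF (sv a (~~ e) e) 1?symX //.
  case: ifP => _; first exact: raag_refl.
  exact/raag_swap/adjYl.
- by rewrite !addbF; apply/raag_swap/adjYl.
Qed.

Lemma schreier_raag u w : eqX u w -> schreier_eq (schreier u) (schreier w).
Proof.
elim=> [{}u {}w st|{}u|{}u {}w _ [e1 e2]|{}u u' {}w _ [e1 e2] _ [e3 e4]].
- rewrite /schreier; case: st => [w1 w2 a b|w1 w2 a c b d ac]; rewrite !foldr_cat.
    exact/foldr_schreier_eq/schreier_step_cancel.
  exact/foldr_schreier_eq/schreier_step_comm.
- by split=> //; apply: raag_refl.
- by split; [rewrite e1 | apply: raag_sym].
- by split; [rewrite e1 | apply: raag_trans e4].
Qed.

(** [schreier] respects the congruence and is a left inverse of [unfold]. *)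
Lemma unfold_faithful h h' : eqX (unfold h) (unfold h') -> eqY h h'.
Proof. by case/schreier_raag; rewrite !schreier_unfold. Qed.

Lemma size_foldr_schreier u z :
  size (foldr schreier_step z u).2 <= size z.2 + size u.
Proof.
elim: u => [|l u IH] /=; first by rewrite addn0.
by rewrite addnS; case: ifP => _ //=; apply: leqW.
Qed.

Lemma size_schreier u : size (schreier u).2 <= size u.
Proof. exact: size_foldr_schreier. Qed.

(** The last letter is read first, at e = 0; being t, it is absorbed without emitting a letter. This
    is the source of all progress. *)
Lemma size_schreier_rcons u : size (schreier (rcons u (v, s))).2 <= size u.
Proof.
rewrite /schreier foldr_rcons (_ : schreier_step _ _ = (true, [::])).
  exact: size_foldr_schreier.
by rewrite /schreier_step /= !eqxx.
Qed.

End Schreier.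

(** * Values of the generators of the double in a group *)

Section DoubleEvaluation.
Local Open Scope group_scope.
Variables (X : Defs.fgraph) (v : fvert X) (s : bool) (G : groupType).
Variables (f : fvert X -> G) (n : fvert X -> nat).
Hypothesis fC : forall x y, fadj X x y -> commute (f x) (f y).

Definition powers (x : fvert X) : G := f x ^+ n x.

Local Notation t := (eval_letter powers (v, s)).

Definition dbl_root (y : dbl_vert v) : G :=
  if dbl_side y then f (dbl_proj y) ^ t else f (dbl_proj y).

(** The square v^2 goes into the exponent, so that the root at v stays a vertex of the extension
    graph. *)
Definition dbl_exp (y : dbl_vert v) : nat :=
  if dbl_proj y == v then (n v).*2 else n (dbl_proj y).

Definition dbl_powers (y : dbl_vert v) : G := dbl_root y ^+ dbl_exp y.

Lemma conj_star x : star v x -> f x ^ t = f x.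
Proof.
move=> sx; suff ct : commute (f x) t by rewrite conjgE ct mulKg.
apply/commute_eval_letter/commuteX; case/orP: sx => [/eqP-> //|vx].
exact/commute_sym/fC.
Qed.

Lemma dbl_root_lift e x : dbl_root (dbl_lift v e x) = f x ^ (t ^+ e).
Proof.
rewrite /dbl_root dbl_liftK dbl_side_lift.
case: e => /=; last by rewrite conjg1.
by case: (boolP (star v x)) => //= /conj_star ->.
Qed.

Lemma dbl_root_comm a b : dbl_adj a b -> commute (dbl_root a) (dbl_root b).
Proof.
rewrite -{2}(dbl_projK a) -{2}(dbl_projK b) !dbl_root_lift dbl_adjE.
case/andP=> ab; set x := dbl_proj a in ab *; set y := dbl_proj b in ab *.
have key c : commute (f x ^ c) (f y ^ c).
  by rewrite /commute -!conjMg fC.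
(* Adjacent vertices on different sides include a star vertex, which t fixes; its side can be
   flipped to match the other. *)
have fixt (e : bool) z : star v z -> f z ^ (t ^+ e) = f z ^ (t ^+ ~~ e).
  by move=> sz; case: e => /=; rewrite ?conjg1 conj_star.
case: (dbl_side a =P dbl_side b) => [-> // _|ne]; rewrite orbF.
have -> : dbl_side a = ~~ dbl_side b by case: (dbl_side a) (dbl_side b) ne => [] [].
by case/orP=> sz; [rewrite fixt | rewrite [f y ^ _]fixt]; rewrite ?negbK.
Qed.

Lemma dbl_powersE y : dbl_powers y =
  if dbl_proj y == v then powers v * powers v
  else powers (dbl_proj y) ^ (t ^+ dbl_side y).
Proof.
rewrite /dbl_powers /dbl_exp -{1}(dbl_projK y) dbl_root_lift -conjXg.
case: eqP => [->|//]; rewrite -addnn expgnDr -/(powers v) conjMg.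
suff -> (e : bool) : powers v ^ (t ^+ e) = powers v by [].
rewrite conjXg; congr (_ ^+ _); case: e; rewrite ?conjg1 //= conj_star //.
exact: star_self.
Qed.

Lemma eval_unfold_letter l :
  eval powers (unfold_letter s l) = eval_letter dbl_powers l.
Proof.
case: l => y b; rewrite /unfold_letter [RHS]/eval_letter /= dbl_powersE.
case: eqP => [_|_].
  rewrite !eval_cons eval_nil mulg1 /eval_letter /=.
  by case: b; rewrite ?invMg.
case: (dbl_side y); rewrite !eval_cons eval_nil mulg1 ?conjg1 //.
rewrite eval_letterN [eval_letter _ (_, b)]/eval_letter /=.
by case: b; rewrite // -conjVg.
Qed.

Lemma eval_unfold h : eval powers (unfold s h) = eval dbl_powers h.
Proof.
elim: h => [|l h IH]; first by rewrite !eval_nil.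
by rewrite unfold_cons eval_cat IH eval_cons eval_unfold_letter.
Qed.

(** The decomposition u = t^e h read in the target group, by multiplying by one letter at a time. *)
Lemma eval_schreier u : eval powers u =
  t ^+ (schreier v s u).1 * eval dbl_powers (schreier v s u).2.
Proof.
elim: u => [|[x b] u IH]; first by rewrite !eval_nil mulg1.
rewrite eval_cons {}IH /=; case: (schreier v s u) => e h /=.
rewrite /schreier_step /=.
have lE : eval_letter dbl_powers (dbl_lift v e x, b) =
   if x == v then eval_letter powers (v, b) ^+ 2
   else eval_letter powers (x, b) ^ (t ^+ e).
  rewrite /eval_letter /= dbl_powersE dbl_liftK dbl_side_lift.
  case: (x =P v) => _; first by case: b; rewrite ?invMg.
  have -> : powers x ^ (t ^+ (e && ~~ star v x)) = powers x ^ (t ^+ e).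
    case: (boolP (star v x)) => sx; rewrite ?andbT // andbF conjg1 /powers conjXg.
    by case: e; rewrite ?conjg1 //= conj_star.
  by case: b; rewrite // -conjVg.
case: (x =P v) lE => [->|_] lE /=; last first.
  by rewrite addbF eval_cons lE conjgE !mulgA mulgV mul1g.
rewrite addbT; have [bs|/eqP bs] := eqVneq b s.
  rewrite bs in lE *; case: e lE => lE /=; rewrite expg0 expg1 mul1g //.
  by rewrite eval_cons lE expg2 !mulgA.
have {}bs : b = ~~ s by case: (b) (s) bs => [] [].
have tV : eval_letter powers (v, ~~ s) = t^-1 by apply: eval_letterN.
rewrite bs tV in lE *; case: e lE => lE /=; rewrite expg0 expg1 mul1g ?mulKg //.
by rewrite eval_cons lE expg2 !mulgA mulgV mul1g.
Qed.

End DoubleEvaluation.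

(** * Isomorphism invariance of doubling *)

Section GraphIsomorphism.
Implicit Types G H K : Defs.fgraph.

Lemma graph_iso_sym G H : graph_iso G H -> graph_iso H G.
Proof.
case=> f [[g fK gK] fE]; exists g; split; first by exists f.
by move=> x y; rewrite fE !gK.
Qed.

Lemma graph_iso_trans G H K : graph_iso G H -> graph_iso H K -> graph_iso G K.
Proof.
case=> f [bf fE] [g [bg gE]]; exists (g \o f); split; first exact: bij_comp.
by move=> x y; rewrite fE gE.
Qed.

Lemma dbl_lift_id (G : Defs.fgraph) (v : fvert G) y :
  dbl_lift v (dbl_side y && ~~ star v (dbl_proj y)) (dbl_proj y) = y.
Proof. by rewrite -dbl_side_lift (dbl_projK y) dbl_projK. Qed.

Lemma graph_iso_star_double G H (v : fvert G) :
  graph_iso G H -> exists w : fvert H, graph_iso (star_double v) (star_double w).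
Proof.
case=> f [[g fK gK] fE]; exists (f v).
have starE x : star (f v) (f x) = star v x.
  by rewrite /star -fE (inj_eq (can_inj fK)).
pose F (y : dbl_vert v) := dbl_lift (f v) (dbl_side y) (f (dbl_proj y)).
exists F; split.
  exists (fun z => dbl_lift v (dbl_side z) (g (dbl_proj z))) => [y|z].
    by rewrite /F dbl_liftK dbl_side_lift starE fK dbl_lift_id.
  rewrite /F dbl_liftK dbl_side_lift -starE gK.
  exact: dbl_lift_id.
have sideF y : dbl_side (F y) = dbl_side y.
  by rewrite dbl_side_lift starE -dbl_side_lift dbl_projK.
by move=> x y /=; rewrite !dbl_adjE !sideF /F !dbl_liftK !starE -fE.
Qed.

End GraphIsomorphism.

(** * Finite graphs marked by vertices of the extension graph *)

Section MarkedGraphs.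
Local Open Scope group_scope.
Variables (T : finType) (E : rel T).

(* A finite graph mapped to the extension graph so that suitable powers of the
   images of its vertices freely generate a right-angled Artin group. *)
Record marked := Marked {
  mgraph : Defs.fgraph;
  mroot : fvert mgraph -> raag E;
  mexp : fvert mgraph -> nat;
  mbase : fvert mgraph;
  msym : symmetric (fadj mgraph);
  mirr : irreflexive (fadj mgraph);
  mroot_ext : forall x, exists a g, mroot x = gen E a ^ g;
  mexp_gt0 : forall x, 0 < mexp x;
  mroot_comm : forall x y, fadj mgraph x y -> commute (mroot x) (mroot y);
  mfaithful : forall u w, eval (powers mroot mexp) u = eval (powers mroot mexp) w ->
    raag_eq (fadj mgraph) u w }.

Implicit Types M : marked.
Local Notation mpowers M := (powers (@mroot M) (@mexp M)).

(** If x and y had equal roots, faithfulness would equate the power of x with exponent [mexp y] and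
    that of y with exponent [mexp x] in the abstract group. *)
Lemma mroot_inj M : injective (@mroot M).
Proof.
move=> x y xy; apply/eqP; case: eqP => // /eqP nxy; exfalso.
apply: (@expg_gen_neq _ (fadj (mgraph M)) _ _ (mexp y) (mexp x) nxy).
  exact: mexp_gt0.
have e z k : gen (fadj (mgraph M)) z ^+ k = raag_class _ (nseq k (z, false)).
  by rewrite -eval_gen eval_nseq.
rewrite !e; apply/raag_classP/mfaithful; rewrite !eval_nseq /eval_letter /=.
by rewrite /powers xy -!expgnA mulnC.
Qed.

(** Ensures an induced subgraph: if roots commute, so do their powers, hence by faithfulness the
    abstract generators, which forces adjacency. *)
Lemma mroot_adj M x y :
  fadj (mgraph M) x y <-> mroot x <> mroot y /\ commute (mroot x) (mroot y).
Proof.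
split=> [xy|[nxy cxy]].
  split; last exact: mroot_comm.
  by move/mroot_inj => e; rewrite e mirr in xy.
apply: commute_gen; [exact: msym | exact: mirr | |].
  by apply/eqP => e; rewrite e in nxy.
apply/wcommuteP/mfaithful; rewrite !eval_cat !eval_cons eval_nil !mulg1.
exact: commuteX2.
Qed.

(** * Doubling a marked graph *)

Section Double.
Variables (M : marked) (v : fvert (mgraph M)) (s : bool).

Lemma dbl_root_ext (y : dbl_vert v) :
  exists a g, dbl_root s (@mroot M) (@mexp M) y = gen E a ^ g :> raag E.
Proof.
have [a [g rE]] := mroot_ext (dbl_proj y); rewrite /dbl_root rE.
by case: ifP => _; [exists a; rewrite -conjgM | exists a, g]; eexists.
Qed.

Lemma dbl_exp_gt0 y : 0 < dbl_exp (v := v) (@mexp M) y.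
Proof. by rewrite /dbl_exp; case: ifP; rewrite ?double_gt0 mexp_gt0. Qed.

Lemma dbl_faithful u w :
  eval (dbl_powers (v := v) s (@mroot M) (@mexp M)) u =
  eval (dbl_powers (v := v) s (@mroot M) (@mexp M)) w ->
  raag_eq (@dbl_adj (mgraph M) v) u w.
Proof.
rewrite -!eval_unfold; try exact: mroot_comm.
by move/mfaithful/unfold_faithful; apply; [exact: msym | exact: mirr].
Qed.

Definition mdouble : marked :=
  @Marked (star_double v) (dbl_root (v := v) s (@mroot M) (@mexp M))
    (dbl_exp (v := v) (@mexp M))
    (dbl_lift v false v) (dbl_adj_sym (@msym M)) (dbl_adj_irr (@mirr M))
    dbl_root_ext dbl_exp_gt0 (dbl_root_comm _ _ (@mroot_comm M)) dbl_faithful.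

End Double.

(** * Conjugator length as the measure of progress *)

Definition within M (k : nat) (g : raag E) : Prop :=
  exists (y : fvert (mgraph M)) w, size w <= k /\ g = mroot y ^ eval (mpowers M) w.

(** Write the conjugator as t^e h: conjugation by t^e moves y to its copy on side e, and h
    remains. *)
Lemma within_mdouble_schreier M v s (y : fvert (mgraph M)) w :
  within (@mdouble M v s) (size (schreier v s w).2)
    (mroot y ^ eval (mpowers M) w).
Proof.
rewrite (eval_schreier v s) ?conjgM -?dbl_root_lift; try exact: mroot_comm.
by exists (dbl_lift v (schreier v s w).1 y), (schreier v s w).2.
Qed.

Lemma within_leq M k k' g : k <= k' -> within M k g -> within M k' g.
Proof. by move=> kk' [y [w [wk ->]]]; exists y, w; rewrite (leq_trans wk). Qed.

Lemma within_mdouble M v s k g : within M k g -> within (@mdouble M v s) k g.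
Proof.
case=> y [w [wk ->]]; apply: within_leq (within_mdouble_schreier v s y w).
exact: leq_trans (size_schreier v s w) wk.
Qed.

Lemma within0 M g : within M 0 g -> exists y : fvert (mgraph M), g = mroot y.
Proof. by case=> y [[|? ?] [] // _ ->]; exists y; rewrite eval_nil conjg1. Qed.

Lemma within_progress M g k : within M k.+1 g ->
  exists v s, within (@mdouble M v s) k g.
Proof.
case=> y [w]; case/lastP: w => [|w [v s]] [wk ->].
  exists y, true; apply: within_leq (within_mdouble_schreier y true y [::]).
  by [].
exists v, s; apply: within_leq (within_mdouble_schreier v s y _).
apply: leq_trans (size_schreier_rcons v s w) _.
by rewrite size_rcons in wk.
Qed.

(** One doubling must serve all k at once, so it is chosen for the least k that works. If there is
    none, or it is 0, any doubling does, and [mbase] supplies a vertex. *)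
Lemma exists_mdouble M g : exists M',
  [/\ exists v, mgraph M' = star_double (X := mgraph M) v,
      forall k h, within M k h -> within M' k h
    & forall k, within M k.+1 g -> within M' k g].
Proof.
have [[k0 k0P]|no] := pselect (exists k, within M k g); last first.
  exists (mdouble (mbase M) true); split; first by exists (mbase M).
    by move=> k h; apply: within_mdouble.
  by move=> k Wk; case: no; exists k.+1.
have ex : exists k, `[< within M k g >] by exists k0; apply/asboolP.
case: (ex_minnP ex) => [[|m]] /asboolP mP minm.
  exists (mdouble (mbase M) true); split; first by exists (mbase M).
    by move=> k h; apply: within_mdouble.
  by move=> k _; apply/within_mdouble/(within_leq (leq0n k) mP).
have [v [s vsP]] := within_progress mP.
exists (mdouble v s); split; first by exists v.
  by move=> k h; apply: within_mdouble.
by move=> k /asboolP/minm mk; apply: within_leq vsP.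
Qed.

(** * Marked graphs as lists of representative words *)

Definition mlist M : seq (word T) :=
  [seq repr (mroot x) | x <- enum (fvert (mgraph M))].

Section MarkedList.
Variable M : marked.
Local Notation Y := (fvert (mgraph M)).

Lemma size_mlist : size (mlist M) = #|Y|.
Proof. by rewrite size_map cardE. Qed.

Definition mlist_vert (i : 'I_(size (mlist M))) : Y :=
  enum_val (cast_ord size_mlist i).

Lemma mlist_vert_bij : bijective mlist_vert.
Proof.
exists (fun x => cast_ord (esym size_mlist) (enum_rank x)) => [i|x].
  by rewrite /mlist_vert enum_valK cast_ordK.
by rewrite /mlist_vert cast_ordKV enum_rankK.
Qed.

Lemma raag_class_mlist (i : 'I_(size (mlist M))) :
  raag_class E (nth [::] (mlist M) i) = mroot (mlist_vert i).
Proof.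
have iY : i < size (enum Y) by rewrite -cardE -size_mlist.
rewrite (nth_map (mlist_vert i)) // repr_raag; congr mroot.
exact/esym/enum_val_nth.
Qed.

Lemma mlist_ext_vset : ext_vset E (mlist M).
Proof.
split=> [u /mapP[x _ ->]|i j /raag_classP].
  by apply/is_ext_vertexP; rewrite repr_raag; apply: mroot_ext.
by rewrite !raag_class_mlist => /mroot_inj/(bij_inj mlist_vert_bij).
Qed.

Lemma ext_subgraph_mlist : graph_iso (ext_subgraph E (mlist M)) (mgraph M).
Proof.
exists mlist_vert; split=> [|i j]; first exact: mlist_vert_bij.
apply/asboolP/idP; rewrite wcommuteP -raag_classP !raag_class_mlist.
  by move/mroot_adj.
by move/mroot_adj.
Qed.

(** Adjacency depends only on classes in A(Gamma), so sending each word to the vertex with the same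
    class is an induced embedding. *)
Lemma mlist_covers (S : seq (word T)) : ext_vset E S ->
  (forall i : 'I_(size S), within M 0 (raag_class E (nth [::] S i))) ->
  induced_emb (ext_subgraph E S) (ext_subgraph E (mlist M)).
Proof.
move=> [_ Suniq] MS.
have [h hK hV] := mlist_vert_bij.
have [f fP] := choice (fun i => within0 (MS i)).
exists (h \o f); have hfP i : raag_class E (nth [::] (mlist M) (h (f i))) =
    raag_class E (nth [::] S i) by rewrite raag_class_mlist hV -fP.
split=> [i j /(congr1 mlist_vert) /=|i j].
  by rewrite !hV => fij; apply/Suniq/raag_classP; rewrite !fP fij.
by apply/asboolP/asboolP; rewrite !wcommuteP -!raag_classP /= !hfP.
Qed.

End MarkedList.

(** * Scheduling the doublings, starting from Gamma itself *)

Section Exhaustion.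
Hypotheses (Esym : symmetric E) (Eirr : irreflexive E).

Lemma gen_ext x : exists a g, gen E x = gen E a ^ g.
Proof. by exists x, 1; rewrite conjg1. Qed.

Lemma gen_comm x y : E x y -> commute (gen E x) (gen E y).
Proof. by move=> xy; apply/wcommuteP/raag_swap. Qed.

Lemma gen_faithful u w :
  eval (powers (X := @FGraph T E) (gen E) (fun=> 1%N)) u =
  eval (powers (X := @FGraph T E) (gen E) (fun=> 1%N)) w -> raag_eq E u w.
Proof. by move=> uw; apply/raag_classP; rewrite -!eval_gen; apply: uw. Qed.

Definition mgen (x : T) : marked :=
  @Marked (@FGraph T E) (gen E) (fun=> 1%N) x Esym Eirr gen_ext
    (fun=> isT) gen_comm gen_faithful.

Lemma within_mgen x a w : within (mgen x) (size w) (gen E a ^ raag_class E w).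
Proof. by exists a, w; rewrite -eval_gen. Qed.

(** The 2-adic valuation takes every value infinitely often, hence so does the decoded word; numbers
    that code no word give the empty word. *)
Definition target (i : nat) : word T := odflt [::] (unpickle (logn 2 i)).

Lemma target_recurrent w i : exists2 j, i <= j & target j = w.
Proof.
(* The odd factor 2i+1 makes the index large without changing its valuation. *)
exists (2 ^ pickle w * i.*2.+1)%N.
  rewrite (leq_trans _ (leq_pmull _ _)) ?expn_gt0 //.
  by rewrite -addnn -addnS leq_addr.
rewrite /target (_ : logn 2 _ = pickle w) ?pickleK //.
rewrite lognM ?expn_gt0 // pfactorK // lognE dvdn2 /= odd_double.
exact: addn0.
Qed.

Lemma exhausting_sequence (x : T) : exists M : nat -> marked,
  (forall i, exists v, mgraph (M i.+1) = star_double (X := mgraph (M i)) v) /\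
  (forall u, is_ext_vertex E u ->
    exists i, forall j, i <= j -> within (M j) 0 (raag_class E u)).
Proof.
have [next nextP] := choice (fun Mg : marked * raag E => exists_mdouble Mg.1 Mg.2).
pose M i := iteri i (fun j N => next (N, raag_class E (target j))) (mgen x).
exists M; split=> [i|u].
  by have [] := nextP (M i, raag_class E (target i)).
have mono i j k g : i <= j -> within (M i) k g -> within (M j) k g.
  move=> /subnK <-; elim: (j - i) => // d IH Wi.
  have [_ keep _] := nextP (M (d + i), raag_class E (target (d + i))).
  exact: keep (IH Wi).
(* Induction on the bound: wait, with the bound preserved, until u is the target again; that
   doubling lowers it by one. *)
have reach k i : within (M i) k (raag_class E u) ->
    exists j, within (M j) 0 (raag_class E u).
  elim: k i => [|k IH] i Wi; first by exists i.
  have [j ij tj] := target_recurrent u i.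
  apply: (IH j.+1).
  have [_ _] := nextP (M j, raag_class E (target j)).
  rewrite /= tj => progress; exact: progress (mono _ _ _ _ ij Wi).
case/is_ext_vertexP => a [g ug]; rewrite -(repr_raag g) in ug.
have W0 : within (M 0) (size (repr g)) (raag_class E u).
  by rewrite ug; apply: within_mgen.
have [j Wj] := reach _ _ W0.
by exists j => j' jj'; apply: mono Wj.
Qed.

End Exhaustion.
End MarkedGraphs.

Theorem theorem1p1 (T : finType) (E : rel T)
  (Esym : symmetric E) (Eirr : irreflexive E) (Tne : 0 < #|T|) :
  exists S : nat -> seq (word T),
    (forall i, ext_vset E (S i)) /\
    (forall i, exists v : fvert (ext_subgraph E (S i)),
        graph_iso (ext_subgraph E (S i.+1)) (star_double v)) /\
    (forall S' : seq (word T), ext_vset E S' ->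
        exists i, induced_emb (ext_subgraph E S') (ext_subgraph E (S i))).
Proof.
have [x _] := card_gt0P Tne.
have [M [Mdbl Mcov]] := exhausting_sequence Esym Eirr x.
exists (fun i => mlist (M i)); split; [|split].
- by move=> i; apply: mlist_ext_vset.
- move=> i; have [v vE] := Mdbl i.
  have [w vw] := graph_iso_star_double v (graph_iso_sym (ext_subgraph_mlist (M i))).
  exists w; apply: graph_iso_trans vw.
  by rewrite -vE; apply: ext_subgraph_mlist.
- move=> S' S'ext; have [S'V _] := S'ext.
  have [f fP] := choice (fun i : 'I_(size S') =>
    Mcov _ (S'V _ (mem_nth [::] (ltn_ord i)))).
  (* Vertices once reached persist, so the latest of the finitely many stages contains them all. *)
  exists (\max_i f i); apply: mlist_covers => // i.
  exact/fP/leq_bigmax.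
Qed.
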